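(* Let $\mathcal{A}$ be a complex unital $C^*$-algebra, let $a\in\mathcal{A}$ be a non-zero positive element, and let $x,y\in\mathcal{A}_a$. Then for any real $n>1$, $$v_a^2(x+y)\le v_a^2(x)+v_a^2(y)+v_a(yx)+\frac1n\|x\|_a^{n}+\frac{n-1}{n}\|y\|_a^{\frac{n}{n-1}} .$$
   Context: A functional $f\in\mathcal{A}^*$ is positive ($f\ge 0$) if $f(x^*x)\ge 0$ for all $x\in\mathcal{A}$. $\mathcal{S}_a(\mathcal{A})=\{f\in\mathcal{A}^*: f\ge0,\ f(a)=1\}$; the $a$-numerical radius is $v_a(x)=\sup\{|f(ax)|: f\in\mathcal{S}_a(\mathcal{A})\}$; and $\|x\|_a=\sup\{\sqrt{f(x^*ax)}: f\in\mathcal{S}_a(\mathcal{A})\}$ (possibly $+\infty$ in general, but finite on $\mathcal{A}_a$). An $a$-adjoint of $x\in\mathcal{A}$ is an element $x^{\#_a}\in\mathcal{A}$ with $ax^{\#_a}=x^*a$; $\mathcal{A}_a$ is the set of all elements of $\mathcal{A}$ that have an $a$-adjoint. The notation $v_a^2(x)$ means $(v_a(x))^2$. *)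

(* Defs.v *)
From HB Require Import structures.
From mathcomp Require Import all_boot all_order all_algebra.
From mathcomp Require Import complex.
From mathcomp Require Import all_classical all_reals all_analysis.

Set Implicit Arguments.
Unset Strict Implicit.
Unset Printing Implicit Defensive.

Import Order.TTheory GRing.Theory Num.Theory.
Import ComplexField.Normc.

Local Open Scope classical_set_scope.
Local Open Scope complex_scope.
Local Open Scope ring_scope.

(* Complex unital C*-algebras. The Hierarchy-Builder graph has no join between
   rings and normed modules below numDomainType, so the norm is a field of the
   mixin, with values in R (normc is the R-valued modulus on R[i]). Note that
   algType implies 1 != 0, i.e., the zero algebra is excluded. *)
HB.mixin Record isCStarAlgebra (R : realType) A of GRing.Algebra R[i] A := {
  star : A -> A;
  cnorm : A -> R;
  starK : involutive star;
  starD : {morph star : x y / x + y};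
  starZ : forall (c : R[i]) (x : A), star (c *: x) = c^* *: star x;
  starM : forall x y : A, star (x * y) = star y * star x;
  cnorm_eq0 : forall x : A, cnorm x = 0 -> x = 0;
  cnormZ : forall (c : R[i]) (x : A), cnorm (c *: x) = normc c * cnorm x;
  cnormD : forall x y : A, cnorm (x + y) <= cnorm x + cnorm y;
  cnormM : forall x y : A, cnorm (x * y) <= cnorm x * cnorm y;
  cnorm_star : forall x : A, cnorm (star x * x) = cnorm x ^+ 2;
  cnorm_complete : forall u : nat -> A,
    (forall e : R, 0 < e -> exists N : nat, forall i j : nat,
       (N <= i)%N -> (N <= j)%N -> cnorm (u i - u j) < e) ->
    exists l : A, forall e : R, 0 < e -> exists N : nat, forall i : nat,
      (N <= i)%N -> cnorm (u i - l) < e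
}.

#[short(type="cstarAlgType")]
HB.structure Definition CStarAlgebra (R : realType) :=
  {A of isCStarAlgebra R A & GRing.Algebra R[i] A}.

Section ANumericalRadius.
Context {R : realType} {A : cstarAlgType R}.
Implicit Types (a x z : A) (f : {scalar A}).

Definition positive_elt a := exists b : A, a = star b * b.

Definition bounded_functional f :=
  exists M : R, forall x, normc (f x) <= M * cnorm x.

(* The order of R[i] is partial: 0 <= z says that z is real and nonnegative. *)
Definition positive_functional f := forall x, 0 <= f (star x * x).

Definition a_states a : set {scalar A} :=
  [set f | [/\ bounded_functional f, positive_functional f & f a = 1]].

(* Suprema of nonnegative quantities are taken in [0, +oo]; adjoining 0 only
   says that the supremum of the empty family is 0 (and not -oo). *)
Definition nnsup (I : Type) (S : set I) (F : I -> R) : \bar R :=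
  ereal_sup (0%E |` [set (F i)%:E | i in S]).

Definition a_numradius a x : \bar R :=
  nnsup (a_states a) (fun f => normc (f (a * x))).

(* For a positive, f (star x * a * x) is a nonnegative real of R[i], and
   complex.Re reads it as an element of R. *)
Definition a_norm a x : \bar R :=
  nnsup (a_states a) (fun f => Num.sqrt (complex.Re (f (star x * a * x)))).

Definition is_a_adjoint a x z := a * z = star x * a.

Definition a_adjointable a : set A := [set x | exists z, is_a_adjoint a x z].

End ANumericalRadius.

(* Main.v *)
Require Import Defs.
From HB Require Import structures.
From mathcomp Require Import all_boot all_order all_algebra.
From mathcomp Require Import complex ring lra.
From mathcomp Require Import all_classical all_reals all_analysis.

Set Implicit Arguments.
Unset Strict Implicit.
Unset Printing Implicit Defensive.

Import Order.TTheory GRing.Theory Num.Theory.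
Import ComplexField.Normc.

Local Open Scope classical_set_scope.
Local Open Scope ring_scope.

(* For an a-state f, <u, v> = f (v^* a u) is a semi-inner product with
   <1, 1> = 1. If w is an a-adjoint of y, then <x, 1> = f (a x),
   <1, w> = f (a y) and <x, w> = f (a y x), so Buzano's inequality reads
     2 |f (a x)| |f (a y)| <= |f (a y x)| + |x|_f |w|_f.
   Expanding |f (a x) + f (a y)|^2 and applying Young's inequality to
   |x|_f |w|_f gives the theorem, once |w|_f <= ||y||_a is known. *)

(** * Semi-inner products: the Cauchy-Schwarz and Buzano inequalities *)

Record semi_inner (C : numClosedFieldType) (V : lmodType C) (B : V -> V -> C)
    : Prop := {
  semi_innerDl : forall x y z, B (x + y) z = B x z + B y z;
  semi_innerZl : forall c x y, B (c *: x) y = c * B x y;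
  semi_innerDr : forall x y z, B x (y + z) = B x y + B x z;
  semi_innerZr : forall c x y, B x (c *: y) = c^* * B x y;
  semi_inner_ge0 : forall x, 0 <= B x x }.

Section SemiInner.
Context (C : numClosedFieldType) (V : lmodType C) (B : V -> V -> C).
Context (Bs : semi_inner B).
Implicit Types x y e w : V.

Let BE := (semi_innerDl Bs, semi_innerDr Bs, semi_innerZl Bs, semi_innerZr Bs).

(** Polarization: [B z z] is real at [z = x + y] and at [z = x + 'i *: y], and a linear combination
    of these two facts isolates [B y x]. *)
Lemma semi_innerC x y : B y x = (B x y)^*.
Proof.
have q_real z : (B z z)^* = B z z.
  by apply/CrealP/ger0_real/(semi_inner_ge0 Bs).
have h1 := q_real (x + y); have h2 := q_real (x + 'i *: y).
have nz2 : (2 : C) != 0 by rewrite pnatr_eq0.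
have nzi : ('i : C) != 0 by rewrite neq0Ci.
move: h1 h2; rewrite !BE !(rmorphD, rmorphM) /= !q_real conjCK conjCi.
move=> /eqP; rewrite -subr_eq0 => /eqP h1 /eqP; rewrite -subr_eq0 => /eqP h2.
have {}h2 : (B x y)^* - (B y x)^* + B x y - B y x = 0.
  by apply: (mulfI nzi); rewrite mulr0 -h2; ring.
apply: (mulfI nz2); apply: subr0_eq.
by rewrite -[RHS]oppr0 -[in RHS](addr0 0) -{1}h1 -h2; ring.
Qed.

Lemma semi_inner_CauchySchwarz_sqr x y : `|B x y| ^+ 2 <= B x x * B y y.
Proof.
move Ep: (`|B x y| ^+ 2) => p; have p0 : 0 <= p by rewrite -Ep exprn_ge0.
have xx0 := semi_inner_ge0 Bs x; have yy0 := semi_inner_ge0 Bs y.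
(* Nonnegativity of the form at [x - s <x, y> y], a quadratic in the real parameter [s]. *)
have quad s : s \is Num.real -> 0 <= B x x - s * p * 2 + s ^+ 2 * p * B y y.
  move=> /conj_Creal sr.
  have := semi_inner_ge0 Bs (x + (- (s * B x y)) *: y).
  rewrite !BE (semi_innerC x y) rmorphN rmorphM /= sr.
  rewrite -Ep normCK; congr (0 <= _); ring.
have [yy|yy] := eqVneq (B y y) 0.
  rewrite yy mulr0; case: (eqVneq p 0) => [->//|pn0].
  (* When [<y, y> = 0] the quadratic is affine in [s], and this [s] gives it the value -1. *)
  have /quad : (B x x + 1) / (p * 2) \is Num.real.
    by rewrite ger0_real // divr_ge0 ?addr_ge0 ?mulr_ge0.
  rewrite yy mulr0 addr0 -mulrA divfK ?mulf_neq0 ?pnatr_eq0 //.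
  by rewrite opprD addrA subrr add0r oppr_ge0 ler10.
(* The quadratic is minimal at [s = 1 / <y, y>], with value [<x, x> - p / <y, y>]. *)
have /quad : (B y y)^-1 \is Num.real by rewrite realV ger0_real.
move=> /(mulr_ge0 yy0) h; rewrite -subr_ge0; move: h.
by congr (0 <= _); field.
Qed.

Lemma semi_inner_CauchySchwarz x y :
  `|B x y| <= sqrtC (B x x) * sqrtC (B y y).
Proof.
have s0 z : 0 <= sqrtC (B z z) by rewrite sqrtC_ge0 (semi_inner_ge0 Bs).
rewrite -(@ler_pXn2r _ 2) ?nnegrE ?mulr_ge0 // exprMn !sqrtCK.
exact: semi_inner_CauchySchwarz_sqr.
Qed.

(* x |-> 2 <x, e> e - x is an isometry (a reflection), to which
   Cauchy-Schwarz is applied. *)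
Lemma semi_inner_Buzano e x w : B e e = 1 ->
  2 * `|B x e * B e w| <= `|B x w| + sqrtC (B x x) * sqrtC (B w w).
Proof.
move=> ee; set r := (2 * B x e) *: e + (-1) *: x.
have rw : B r w = 2 * (B x e * B e w) - B x w by rewrite /r !BE; ring.
have rr : B r r = B x x.
  rewrite /r !BE ee (semi_innerC x e) rmorphM rmorphN /= rmorph1 conjC_nat.
  ring.
have := semi_inner_CauchySchwarz r w; rewrite rr rw => h.
(* Triangle inequality for [2 <x, e> <e, w> = <r, w> + <x, w>]. *)
rewrite -[leLHS]/(2 * _) -{1}[2]normr_nat -normrM.
rewrite -[2 * _](subrK (B x w)) addrC.
by rewrite (le_trans (ler_normD _ _)) // lerD2l.
Qed.

End SemiInner.

Lemma normc_ge0 (R : rcfType) (z : complex R) : 0 <= normc z.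
Proof. by rewrite -lecR; exact: (normr_ge0 z). Qed.

(** * The semi-inner product of a positive functional, and compressions *)

Section StarAlgebra.
Local Open Scope complex_scope.
Context (R : realType) (A : cstarAlgType R).
Implicit Types (a t x y z : A) (f : {scalar A}).

Lemma star1 : star (1 : A) = 1.
Proof. by rewrite -[LHS]mulr1 -{2}(starK 1) -starM mulr1 starK. Qed.

Lemma positive_elt_star a : positive_elt a -> star a = a.
Proof. by case=> b ->; rewrite starM starK. Qed.

Lemma a_adjoint_star a y w :
  positive_elt a -> is_a_adjoint a y w -> star w * a = a * y.
Proof.
move=> ap aw; rewrite -{1}(positive_elt_star ap) -starM aw starM starK.
by rewrite positive_elt_star.
Qed.

(** Follows from [0 = cnorm (x - x) <= 2 * cnorm x]. *)
Lemma cnorm_ge0 x : 0 <= cnorm x.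
Proof.
have n0 : cnorm (0 : A) = 0 by rewrite -(scale0r (0 : A)) cnormZ normc0 mul0r.
have nN : cnorm (- x) = cnorm x.
  rewrite -scaleN1r cnormZ.
  suff -> : normc (-1 : R[i]) = 1 by rewrite mul1r.
  by apply: complexI; rewrite -[LHS]/`|-1 : R[i]| normrN1.
by have := cnormD x (- x); rewrite subrr n0 nN; lra.
Qed.

Definition a_form f a x y := f (star y * a * x).

(** With [a = b^* b], the value [f (x^* a x)] is [f ((b x)^* (b x))], so positivity of [f]
    applies. *)
Lemma a_form_semi_inner f a :
  positive_functional f -> positive_elt a -> semi_inner (a_form f a).
Proof.
move=> fp [b ->]; split=> [x y z|c x y|x y z|c x y|x]; rewrite /a_form.
- by rewrite mulrDr linearD.
- by rewrite -scalerAr linearZ.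
- by rewrite starD !mulrDl linearD.
- by rewrite starZ -!scalerAl linearZ.
- by have := fp (b * x); rewrite starM !mulrA.
Qed.

(** The contribution of a single [f] to the supremum [a_norm a x]. *)
Definition a_seminorm f a x : R := Num.sqrt (complex.Re (a_form f a x x)).

Lemma a_seminormE f a x : positive_functional f -> positive_elt a ->
  sqrtC (a_form f a x x) = (a_seminorm f a x)%:C.
Proof.
move=> fp ap; have q0 := semi_inner_ge0 (a_form_semi_inner fp ap) x.
have r0 : 0 <= complex.Re (a_form f a x x).
  by rewrite -lecR RRe_real ?ger0_real.
rewrite -{1}(RRe_real (ger0_real q0)) -(sqr_sqrtr r0) rmorphXn /=.
by rewrite sqrCK // lecR sqrtr_ge0.
Qed.

(** Source of new a-states: the weight [c] will be [1 / f (z^* a z)], which makes the value at [a]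
    equal to 1. *)
Definition compression f (c : R[i]) z : A -> R[i] :=
  fun t => c * f (star z * t * z).

Lemma compression_is_scalar f c z : scalar (compression f c z).
Proof.
move=> k t u; rewrite /compression mulrDr mulrDl linearD /=.
by rewrite -scalerAr -scalerAl linearZ /= mulrDr mulrCA.
Qed.

HB.instance Definition _ f c z :=
  GRing.isLinear.Build R[i] A R[i] _ (compression f c z)
    (compression_is_scalar f c z).

Lemma compression_bounded f c z :
  bounded_functional f -> bounded_functional (compression f c z).
Proof.
move=> [M fM].
(* The absolute value of [M] is taken because the sign of [M] is unknown and the product estimates
   need a nonnegative factor. *)
exists (normc c * (`|M| * cnorm (star z) * cnorm z)) => t.
rewrite /= /compression normcM -[leRHS]mulrA.
apply: ler_wpM2l; first exact: normc_ge0.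
apply: le_trans (fM _) _.
apply: le_trans (ler_wpM2r (cnorm_ge0 _) (ler_norm M)) _.
rewrite -[leRHS]mulrA -[leRHS]mulrA; apply: ler_wpM2l => //.
apply: le_trans (cnormM _ _) _; rewrite [cnorm z * _]mulrC [leRHS]mulrA.
by apply: ler_wpM2r; [exact: cnorm_ge0 | exact: cnormM].
Qed.

Lemma compression_positive f c z :
  0 <= c -> positive_functional f -> positive_functional (compression f c z).
Proof.
move=> c0 fp x; rewrite mulr_ge0 //.
by have := fp (x * z); rewrite starM !mulrA.
Qed.

Lemma compression_a_state f a z : bounded_functional f ->
  positive_functional f -> positive_elt a -> a_form f a z z != 0 ->
  a_states a (compression f (a_form f a z z)^-1 z : {scalar A}).
Proof.
move=> fb fp ap nz; split; first exact: compression_bounded.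
  apply: compression_positive => //.
  by rewrite invr_ge0 (semi_inner_ge0 (a_form_semi_inner fp ap)).
exact: mulVf.
Qed.

End StarAlgebra.

(** * Suprema of nonnegative quantities *)

Section NNSup.
Context (R : realType) (I : Type) (S : set I) (F : I -> R).

Lemma nnsup_ge0 : (0 <= nnsup S F)%E.
Proof. by apply: ereal_sup_ubound; left. Qed.

Lemma nnsup_ubound i : S i -> ((F i)%:E <= nnsup S F)%E.
Proof. by move=> Si; apply: ereal_sup_ubound; right; exists i. Qed.

(** Reduces the theorem to one a-state at a time. For finite [B], its square root bounds every [F i]
    and the adjoined 0, hence the supremum, which is then squared. *)
Lemma nnsup_sqr_le (B : \bar R) : (0 <= B)%E ->
  (forall i, S i -> 0 <= F i) ->
  (forall i, S i -> ((F i ^+ 2)%:E <= B)%E) -> (nnsup S F ^+ 2 <= B)%E.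
Proof.
case: B => [r||] // r0 F0 FB; last by rewrite leey.
rewrite lee_fin in r0.
have : (nnsup S F <= (Num.sqrt r)%:E)%E.
  apply: ge_ereal_sup => _ [->|[i Si <-]]; rewrite lee_fin ?sqrtr_ge0 //.
  rewrite -(ger0_norm (F0 _ Si)) -sqrtr_sqr ler_wsqrtr //.
  by rewrite -lee_fin FB.
have := nnsup_ge0; case: (nnsup S F) => // s.
rewrite -EFin_expe !lee_fin => s0 sr.
by rewrite -(sqr_sqrtr r0) ler_pXn2r ?nnegrE ?sqrtr_ge0.
Qed.

End NNSup.

(** * Estimates for a single a-state *)

Section ANorm.
Local Open Scope complex_scope.
Context (R : realType) (A : cstarAlgType R).
Implicit Types (a x y z w : A) (f : {scalar A}).

Lemma a_form1r f a x : a_form f a x 1 = f (a * x).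
Proof. by rewrite /a_form star1 mul1r. Qed.

Lemma a_form_adjoint f a x y w : positive_elt a -> is_a_adjoint a y w ->
  a_form f a x w = f (a * (y * x)).
Proof. by move=> ap aw; rewrite /a_form (a_adjoint_star ap aw) mulrA. Qed.

Lemma a_state_form11 f a : a_states a f -> a_form f a 1 1 = 1.
Proof. by case=> _ _ fa; rewrite a_form1r mulr1. Qed.

Lemma a_seminorm_sqr f a x : positive_functional f -> positive_elt a ->
  (a_seminorm f a x ^+ 2)%:C = a_form f a x x.
Proof.
by move=> fp ap; rewrite rmorphXn /= -(a_seminormE _ fp ap) sqrtCK.
Qed.

Lemma a_seminorm_CauchySchwarz f a x y :
  positive_functional f -> positive_elt a ->
  normc (a_form f a x y) <= a_seminorm f a x * a_seminorm f a y.
Proof.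
move=> fp ap; rewrite -lecR rmorphM /= -!(a_seminormE _ fp ap).
exact: (semi_inner_CauchySchwarz (a_form_semi_inner fp ap)).
Qed.

(** The compressed form at [y] is [f ((y z)^* a (y z)) / f (z^* a z)], a quotient of two squared
    seminorms. *)
Lemma a_seminorm_compression f a z y : positive_functional f ->
  positive_elt a -> a_form f a z z != 0 ->
  a_seminorm (compression f (a_form f a z z)^-1 z : {scalar A}) a y
    = a_seminorm f a (y * z) / a_seminorm f a z.
Proof.
move=> fp ap nz.
have s0 u : 0 <= a_seminorm f a u by exact: sqrtr_ge0.
have E : a_form (compression f (a_form f a z z)^-1 z : {scalar A}) a y y
    = ((a_seminorm f a (y * z) / a_seminorm f a z) ^+ 2)%:C.
  rewrite exprMn exprVn rmorphM fmorphV /= !a_seminorm_sqr // [RHS]mulrC.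
  by rewrite /a_form /= /compression starM !mulrA.
by rewrite {1}/a_seminorm E /= sqrtr_sqr ger0_norm // divr_ge0.
Qed.

(* Applying the a-state t |-> f (w^* t w) / f (w^* a w) to y^* a y gives
   |y w|_f <= ||y||_a |w|_f, while |w|_f ^ 2 = <1, y w>_f <= |y w|_f. *)
Lemma a_seminorm_adjoint_le f a y w : positive_elt a -> is_a_adjoint a y w ->
  a_states a f -> ((a_seminorm f a w)%:E <= a_norm a y)%E.
Proof.
move=> ap aw fS; have [fb fp fa] := fS.
(* If [<w, w> = 0] the compression cannot be normalized, but the left-hand side is then 0. *)
have [ww|ww] := eqVneq (a_form f a w w) 0.
  by rewrite /a_seminorm ww sqrtr0 nnsup_ge0.
have w0 : 0 < a_seminorm f a w.
  rewrite lt_def sqrtr_ge0 andbT; apply: contra_neq ww => w0.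
  by rewrite -a_seminorm_sqr // w0 expr0n.
have hS := compression_a_state fb fp ap ww.
have s1 : a_seminorm f a 1 = 1.
  by rewrite /a_seminorm (a_state_form11 fS) sqrtr1.
have le_w : a_seminorm f a w ^+ 2 <= a_seminorm f a (y * w).
  have := a_seminorm_CauchySchwarz (y * w) 1 fp ap.
  rewrite s1 mulr1; apply: le_trans.
  rewrite -[leLHS]ger0_norm ?exprn_ge0 ?sqrtr_ge0 // -lecR.
  rewrite a_form1r -(a_form_adjoint _ _ ap aw) -a_seminorm_sqr //.
  by rewrite -[leRHS]/`|_%:C| normc_def /= expr0n addr0 sqrtr_sqr.
apply: le_trans (nnsup_ubound _ hS).
rewrite -/(a_seminorm _ a y) a_seminorm_compression // lee_fin.
by rewrite ler_pdivlMr // -expr2.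
Qed.

(** Buzano's inequality with [e = 1] bounds the cross term in the square of
    [|f (a x)| + |f (a y)|]. *)
Lemma a_state_sum_le f a x y w : positive_elt a -> is_a_adjoint a y w ->
  a_states a f ->
  normc (f (a * (x + y))) ^+ 2 <=
    normc (f (a * x)) ^+ 2 + normc (f (a * y)) ^+ 2 + normc (f (a * (y * x)))
    + a_seminorm f a x * a_seminorm f a w.
Proof.
move=> ap aw fS; have [fb fp fa] := fS.
have Buz : 2 * (normc (f (a * x)) * normc (f (a * y))) <=
    normc (f (a * (y * x))) + a_seminorm f a x * a_seminorm f a w.
  have := semi_inner_Buzano (a_form_semi_inner fp ap) x w (a_state_form11 fS).
  rewrite !a_seminormE // a_form1r !(a_form_adjoint _ _ ap aw) mulr1 normrM.
  by rewrite -!rmorphM -rmorphD -(rmorph_nat (real_complex R) 2) -rmorphM lecR.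
have tri : normc (f (a * (x + y))) <= normc (f (a * x)) + normc (f (a * y)).
  by rewrite mulrDr linearD le_normcD.
have := normc_ge0 (f (a * (x + y))).
move: tri Buz (normc_ge0 (f (a * x))) (normc_ge0 (f (a * y))).
set s := normc _; set p := normc _; set q := normc _ => tri Buz p0 q0 s0.
have : s ^+ 2 <= (p + q) ^+ 2 by rewrite ler_pXn2r ?nnegrE ?addr_ge0.
lra.
Qed.

End ANorm.

(** * Young's inequality and passage to the supremum *)

Theorem theorem2p25 (R : realType) (A : cstarAlgType R) (a x y : A) (n : R)
    (a_neq0 : a != 0) (a_pos : positive_elt a)
    (x_adj : x \in a_adjointable a) (y_adj : y \in a_adjointable a)
    (n_gt1 : 1 < n) :
  (a_numradius a (x + y)%R ^+ 2
   <= a_numradius a x ^+ 2 + a_numradius a y ^+ 2 + a_numradius a (y * x)%R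
      + (n^-1)%:E * (a_norm a x `^ n)
      + ((n - 1) / n)%:E * (a_norm a y `^ (n / (n - 1))))%E.
Proof.
have n0 : 0 < n by exact: lt_trans ltr01 n_gt1.
have n10 : 0 < n - 1 by rewrite subr_gt0.
have sqr0 z : (0 <= a_numradius a z ^+ 2)%E.
  by rewrite expe2 mule_ge0 ?nnsup_ge0.
have le_num f z : a_states a f ->
    ((normc (f (a * z)))%:E <= a_numradius a z)%E.
  exact: (nnsup_ubound (fun g : {scalar A} => normc (g (a * z)))).
have le_sqr f z : a_states a f ->
    ((normc (f (a * z)) ^+ 2)%:E <= a_numradius a z ^+ 2)%E.
  move=> fS; rewrite EFin_expe !expe2.
  by apply: lee_pmul; rewrite ?lee_fin ?normc_ge0 //; exact: le_num.
have le_pow c B r : 0 < r -> 0 <= c -> (c%:E <= B)%E ->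
    ((c `^ r)%:E <= B `^ r)%E.
  move=> r0 c0 cB; rewrite -poweR_EFin; apply: (gt0_ler_poweR (ltW r0)) => //.
    by rewrite in_itv/= lee_fin c0 leey.
  by rewrite in_itv/= leey andbT (le_trans _ cB).
move: y_adj; rewrite inE => -[w aw].
apply: nnsup_sqr_le => [|f _|f fS]; [|exact: normc_ge0|].
  by rewrite !adde_ge0 ?mule_ge0 ?nnsup_ge0 ?poweR_ge0 ?lee_fin ?invr_ge0
    ?divr_ge0 // ltW.
have s0 z : 0 <= a_seminorm f a z by exact: sqrtr_ge0.
(* The exponents [n] and [n / (n - 1)] are conjugate, since [1 / n + (n - 1) / n = 1]. *)
have Young : a_seminorm f a x * a_seminorm f a w <=
    n^-1 * a_seminorm f a x `^ n
    + (n - 1) / n * a_seminorm f a w `^ (n / (n - 1)).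
  rewrite [X in X + _]mulrC [X in _ + X]mulrC -(invf_div n (n - 1)).
  apply: conjugate_powR => //; first exact: divr_gt0.
  by rewrite invf_div; field; rewrite !gt_eqF.
apply: (@le_trans _ _ (normc (f (a * x)) ^+ 2 + normc (f (a * y)) ^+ 2
    + normc (f (a * (y * x))) + n^-1 * a_seminorm f a x `^ n
    + (n - 1) / n * a_seminorm f a w `^ (n / (n - 1)))%:E).
  rewrite lee_fin (le_trans (a_state_sum_le _ a_pos aw fS)) //.
  by rewrite -[leRHS]addrA lerD2l.
(* Each term is compared with its own supremum; only the last one, in [w] rather than [y], needs
   [a_seminorm_adjoint_le]. *)
rewrite !EFinD !EFinM; do !apply: leeD; try exact: le_sqr.
- exact: le_num.
- apply: lee_wpmul2l; first by rewrite lee_fin invr_ge0 ltW.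
  by apply: le_pow => //; exact: (nnsup_ubound _ fS).
- apply: lee_wpmul2l; first by rewrite lee_fin divr_ge0 ?ltW.
  apply: le_pow => //; first exact: divr_gt0.
  exact: a_seminorm_adjoint_le aw fS.
Qed.
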